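(* Define a sequence of integer vectors $\beta^{(r)}=(\beta^{(r)}_1,\dots,\beta^{(r)}_r)$ of length $r$ for $r\ge 2$ by $\beta^{(2)}=(3,2)$ and, for $r>2$, \[\beta_i^{(r)}=\begin{cases}2(\beta_i^{(r-1)}+r-2) & i<r,\\ 2r-3 & i=r.\end{cases}\] If $r\ge 2$ and $D$ is a finite digraph containing no $(r-1)$-source sets, then $D$ contains a $\beta^{(r)}$-kernel.
   Context: For $S\subseteq V(D)$, $N^-(S)=\{u\in V(D)\setminus S:\exists v\in S,\ uv\in E(D)\}$. $S$ is a source set if $N^-(S)=\emptyset$; it is an $s$-source set if additionally $S\neq\emptyset$ and $|S|\le s$. A set is independent if there are no arcs between two of its vertices. $\mathrm{dist}(S,v)$ is the minimum over $u\in S$ of the length of a shortest directed path from $u$ to $v$. A $q$-kernel is an independent set $Q$ with $\mathrm{dist}(Q,v)\le q$ for all $v$. Given a vector $\beta$ of length $r$, a $\beta$-kernel of $D$ is a tuple $(Q_1,\dots,Q_r)$ of pairwise disjoint vertex subsets such that each $Q_i$ is a $\beta_i$-kernel of $D$. *)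

(* Defs.v *)
From mathcomp Require Import all_boot.

Set Implicit Arguments.
Unset Strict Implicit.
Unset Printing Implicit Defensive.

(* A finite digraph is an arc relation [E : rel V] on a finite type [V]:
   [E u v] means that uv is an arc.  Opposite arcs uv, vu may coexist.  Loops
   are not excluded, but no notion below is sensitive to them. *)

Section Digraph.
Variables (V : finType) (E : rel V).

Definition in_neighbours (S : {set V}) : {set V} :=
  [set u | (u \notin S) && [exists v in S, E u v]].

Definition source_set (S : {set V}) : Prop := in_neighbours S = set0.

Definition s_source_set (s : nat) (S : {set V}) : Prop :=
  [/\ source_set S, S <> set0 & #|S| <= s].

(* "two of its vertices" means two distinct vertices. *)
Definition independent (S : {set V}) : Prop :=
  forall u v, u \in S -> v \in S -> u <> v -> ~~ E u v.

(* The vertices of the path are u :: p, so its length is [size p]. *)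
Definition dipath (u v : V) (p : seq V) : bool :=
  [&& path E u p, last u p == v & uniq (u :: p)].

Definition dipath_of_length (u v : V) (k : nat) : bool :=
  [exists p : k.-tuple V, dipath u v p].

(* Distances live in [option nat], with [None] standing for infinity. *)
Definition omin (a b : option nat) : option nat :=
  match a, b with
  | Some m, Some n => Some (minn m n)
  | None, _ => b
  | _, None => a
  end.

Definition oleq (a : option nat) (q : nat) : bool :=
  if a is Some k then k <= q else false.

(* Directed paths have no repeated vertex, so their length is below #|V|;
   [find] returns the least such length. *)
Definition vdist (u v : V) : option nat :=
  let k := find (dipath_of_length u v) (iota 0 #|V|) in
  if k < #|V| then Some k else None.

Definition dist (S : {set V}) (v : V) : option nat :=
  \big[omin/None]_(u in S) vdist u v.

Definition kernel (q : nat) (Q : {set V}) : Prop :=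
  independent Q /\ forall v, oleq (dist Q v) q.

Definition vkernel (r : nat) (b : r.-tuple nat) (Q : r.-tuple {set V}) : Prop :=
  (forall i j : 'I_r, i <> j -> [disjoint tnth Q i & tnth Q j]) /\
  (forall i : 'I_r, kernel (tnth b i) (tnth Q i)).

End Digraph.

(* Entry i (numbered from 1) of the vector beta^(r); meaningful only for
   2 <= r and 1 <= i <= r. *)
Fixpoint beta_entry (r i : nat) : nat :=
  if r is r'.+1 then
    if r <= 2 then (if i == 1 then 3 else 2)
    else if i < r then 2 * (beta_entry r' i + (r - 2))
    else 2 * r - 3
  else 0.

Definition beta (r : nat) : r.-tuple nat :=
  [tuple beta_entry r i.+1 | i < r].

(* Main.v *)
Require Import Defs.
From mathcomp Require Import all_boot zify.

Set Implicit Arguments.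
Unset Strict Implicit.
Unset Printing Implicit Defensive.

(** Induction on [r].  For [r = 2], take a quasi-kernel [Q2] of [D] and a
    quasi-kernel [Q1] of [D - Q2]: since [D] has no source, [Q1] reaches [Q2] in
    three steps.

    For [r > 2], one finds a [(2r-3)]-kernel [K] such that the digraph [D / K],
    obtained from [D - K] by adding an arc [uv] for every path [u k v] with [k]
    in [K], has no [(r-2)]-source set.  A [beta^(r-1)]-kernel of [D / K] together
    with [K] is then the required tuple, because an arc of [D / K] is a path of
    length at most two of [D], and every vertex of [K] has an in-neighbour
    outside [K].

    To find [K], start from a quasi-kernel [K0] and let [S] range over the
    minimal [(r-2)]-source sets of [D / K0].  The set [T S], consisting of [S] and
    its in-neighbours (all in [K0]), is a strongly connected source set of [D],
    and so has at least [r] vertices.  In [K0], replace [T S] by one vertex [x]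
    of [S], and delete the out-neighbours of [x].  Since [x] reaches [T S] within
    [2r-5] steps, the new set is a [(2r-3)]-kernel, and [T S - x] is now too
    large to yield a small source set. *)

Section Digraph.
Variable V : finType.
Implicit Types (E : rel V) (A S K C : {set V}) (u v w k x : V).

(** * Walks of bounded length *)

(** Vertices may repeat, so walks concatenate freely; simple paths return only in the comparison
    with [vdist]. *)
Fixpoint within E (n : nat) u v : bool :=
  (u == v) || (if n is m.+1 then [exists w, E u w && within E m w v] else false).

Lemma within_refl E n u : within E n u u.
Proof. by case: n => [|n] /=; rewrite eqxx. Qed.

Lemma within_step E n u w v : E u w -> within E n w v -> within E n.+1 u v.
Proof.
by move=> Euw Wwv; apply/orP; right; apply/existsP; exists w; rewrite Euw.
Qed.

Lemma within_arc E u v : E u v -> within E 1 u v.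
Proof. by move=> Euv; apply: within_step Euv _; apply: within_refl. Qed.

Lemma within_mono E m n u v : m <= n -> within E m u v -> within E n u v.
Proof.
elim: m n u => [|m IHm] n u /=.
  by move=> _; rewrite orbF => /eqP->; apply: within_refl.
case: n => // n lemn /orP[/eqP->|/existsP[w /andP[Euw Wwv]]].
  exact: within_refl.
by apply: within_step Euw _; apply: IHm.
Qed.

Lemma within_trans E m n u w v :
  within E m u w -> within E n w v -> within E (m + n) u v.
Proof.
elim: m u => [|m IHm] u; first by case/orP=> // /eqP->.
case/orP=> [/eqP-> Wwv|/existsP[y /andP[Euy Wyw]] Wwv].
  by apply: within_mono Wwv; apply: leq_addl.
by rewrite addSn; apply: within_step Euy _; apply: IHm.
Qed.

Lemma within_path E n u v :
  within E n u v -> exists p, [/\ path E u p, last u p = v & size p <= n].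
Proof.
elim: n u => [|n IHn] u /=; first by rewrite orbF => /eqP->; exists [::].
case/orP=> [/eqP->|/existsP[w /andP[Euw /IHn[p [pp pl ps]]]]].
  by exists [::].
by exists (w :: p); rewrite /= Euw.
Qed.

(** Shortening the walk to a simple path keeps its length at most [n] and brings it below [#|V|],
    inside the range searched by [vdist]. *)
Lemma oleq_vdist E n u v : within E n u v -> oleq (vdist E u v) n.
Proof.
case/within_path=> p [pp <-]; case/shortenP: pp => p' p'p p'u p's pn.
have {}p's : size p' <= n.
  apply: leq_trans pn; apply: uniq_leq_size; first by case/andP: p'u.
  by move=> y yp'; apply: p's.
have lt_p'V : size p' < #|V| by rewrite -[(size p').+1](card_uniqP p'u) max_card.
rewrite /vdist; set P := dipath_of_length E u _.
have Pp' : P (size p').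
  by apply/existsP; exists (in_tuple p'); rewrite /dipath p'p eqxx p'u.
have le_find : find P (iota 0 #|V|) <= size p'.
  rewrite leqNgt; apply/negP => /(before_find 0).
  by rewrite nth_iota // add0n Pp'.
by rewrite (leq_ltn_trans le_find lt_p'V) /= (leq_trans le_find p's).
Qed.

Lemma oleq_omin q : {morph oleq^~ q : a b / omin a b >-> a || b}.
Proof. by move=> [m|] [n|] //=; rewrite ?orbF // geq_min. Qed.

Lemma oleq_dist E n S u v : u \in S -> within E n u v -> oleq (dist E S v) n.
Proof.
move=> uS Wuv; rewrite /dist (big_morph _ (oleq_omin n) (erefl : oleq None n = false)).
by rewrite big_orE; apply/existsP; exists u; rewrite uS oleq_vdist.
Qed.

(** * Domination and quasi-kernels *)

Definition dominates E (n : nat) A K : Prop :=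
  forall v, v \in A -> exists2 u, u \in K & within E n u v.

(** The Chvátal-Lovász argument: delete some [v] and its out-neighbours and take a quasi-kernel [K]
    of the rest. If [K] has an arc to [v], it reaches the deleted vertices in two steps; otherwise
    [v] can be added to it. *)
Lemma quasi_kernel E A :
  exists K, [/\ K \subset A, independent E K & dominates E 2 A K].
Proof.
have [n leAn] := ubnP #|A|; elim: n A leAn => // n IHn A leAn.
have [->|[v vA]] := set_0Vmem A.
  by exists set0; split; rewrite ?sub0set // => u; rewrite ?in_set0.
pose A' := A :\: (v |: [set w | E v w]).
have sA'A : A' \subset A by apply: subsetDl.
have [|K [sKA' indK domK]] := IHn A'.
  apply: leq_ltn_trans (leqnn _) _; apply: leq_trans (_ : #|A'| < #|A|) leAn.
  apply: proper_card; apply/properP; split=> //; exists v => //.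
  by rewrite !inE eqxx.
have [/existsP[u /andP[uK Euv]]|noK] := boolP [exists u, (u \in K) && E u v].
  exists K; split=> // [|w wA]; first exact: subset_trans sKA' sA'A.
  have [wA'|] := boolP (w \in A'); first exact: domK.
  rewrite !inE wA andbT negbK => /orP[/eqP->|Evw]; exists u => //.
    by apply: within_mono (within_arc Euv).
  exact: within_step Euv (within_arc Evw).
exists (v |: K); split=> [|a b|w wA].
- by rewrite subUset sub1set vA (subset_trans sKA').
- rewrite !inE => /orP[/eqP->|aK] /orP[/eqP->|bK] //.
  + by move=> _; move/(subsetP sKA'): bK; rewrite !inE negb_or => /andP[/andP[]].
  + by move=> _; apply: contra noK => Eav; apply/existsP; exists a; rewrite aK.
  + exact: indK.
- have [wA'|] := boolP (w \in A').
    by have [u uK Wuw] := domK w wA'; exists u => //; rewrite inE uK orbT.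
  rewrite !inE wA andbT negbK => /orP[/eqP->|Evw]; exists v; rewrite ?setU11 //.
    exact: within_refl.
  by apply: within_mono (within_arc Evw).
Qed.

(** * Source sets of an induced subdigraph *)

Definition source_in E A S : bool :=
  (S \subset A) && [forall u in A, forall v in S, E u v ==> (u \in S)].

Definition small_source E A (s : nat) S : bool :=
  [&& S != set0, source_in E A S & #|S| <= s].

Lemma source_inP E A S :
  reflect (S \subset A /\ forall u v, u \in A -> v \in S -> E u v -> u \in S)
          (source_in E A S).
Proof.
apply: (iffP andP) => -[sSA clS]; split=> //.
  by move=> u v uA vS Euv; move/forall_inP/(_ u uA)/forall_inP: clS => /(_ v vS)
     /implyP; apply.
by apply/forall_inP=> u uA; apply/forall_inP=> v vS; apply/implyP; apply: clS.
Qed.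

Lemma source_setP E S : source_in E [set: V] S -> source_set E S.
Proof.
case/source_inP=> _ clS; apply/setP=> u; rewrite !inE; apply/negP.
case/andP=> uS /existsP[v /andP[vS Euv]].
by rewrite (clS u v) ?inE in uS.
Qed.

Lemma source_inI E A S C :
  source_in E A S -> source_in E A C -> source_in E A (S :&: C).
Proof.
case/source_inP=> sSA clS /source_inP[_ clC]; apply/source_inP; split.
  by rewrite subIset ?sSA.
by move=> u v uA /setIP[vS vC] Euv; rewrite inE (clS u v) ?(clC u v).
Qed.

Lemma in_neighbour_of E A s v :
  (forall S, ~~ small_source E A s.+1 S) -> v \in A ->
  exists u, [/\ u \in A, u != v & E u v].
Proof.
move=> noS vA.
have [/existsP[u /and3P[]]|noU] := boolP [exists u, [&& u \in A, u != v & E u v]].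
  by exists u.
case/negP: (noS [set v]); apply/and3P; split; last by rewrite cards1.
  by apply/set0Pn; exists v; rewrite set11.
apply/source_inP; split=> [|u w uA]; first by rewrite sub1set.
rewrite !inE => /eqP-> Euv; apply: contraNT noU => uv.
by apply/existsP; exists u; rewrite uA uv.
Qed.

(* In a minimal source set, the set of vertices within [n] of [v] grows with
   [n] until it is everything. *)
Lemma minimal_source_within E A s S u v :
  minset (small_source E A s) S -> u \in S -> v \in S -> within E s.-1 u v.
Proof.
move=> minS uS vS; have /minsetP[/and3P[_ srcS leSs] min] := minS.
have /source_inP[sSA clS] := srcS.
pose B n := [set w in S | within E n w v].
have grow n : (B n == S) || (n < #|B n|).
  elim: n => [|n IHn].
    apply/orP; right; rewrite card_gt0; apply/set0Pn; exists v.
    by rewrite inE vS within_refl.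
  have sBB : B n \subset B n.+1.
    by apply/subsetP=> w; rewrite !inE => /andP[-> W]; apply: within_mono W.
  have sBS m : B m \subset S by apply/subsetP=> w; rewrite inE => /andP[].
  have [eqBS|neBS] := boolP (B n == S).
    by rewrite eqEsubset sBS -{1}(eqP eqBS) sBB.
  rewrite (negPf neBS) /= in IHn.
  (* By minimality [B n] is not a source set, so some in-neighbour outside it joins at stage
     [n.+1]. *)
  have [src|] := boolP (source_in E A (B n)).
    case/eqP: neBS; apply: min => //; apply/and3P; split=> //.
      by apply/set0Pn; exists v; rewrite inE vS within_refl.
    exact: leq_trans (subset_leq_card (sBS n)) leSs.
  rewrite negb_and (subset_trans (sBS n) sSA) /=.
  rewrite negb_forall_in => /exists_inP[w wA].
  rewrite negb_forall_in => /exists_inP[y yB].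
  rewrite negb_imply => /andP[Ewy wB].
  apply/orP; right; apply: leq_ltn_trans IHn _; apply: proper_card.
  apply/properP; split=> //; exists w => //.
  move: yB; rewrite !inE => /andP[yS Wyv].
  by rewrite (clS w y) // (within_step Ewy Wyv).
have sBS m : B m \subset S by apply/subsetP=> w; rewrite inE => /andP[].
have s_gt0 : 0 < s by apply: leq_trans leSs; rewrite card_gt0; apply/set0Pn; exists v.
(* In the second case [B s.-1] has at least [s] elements, hence at least as many as [S]. *)
have [/eqP eqBS|lt] := orP (grow s.-1).
  by move: uS; rewrite -eqBS inE => /andP[].
have /eqP eqBS : B s.-1 == S by rewrite eqEcard sBS; apply: leq_trans leSs _; lia.
by move: uS; rewrite -eqBS inE => /andP[].
Qed.

(** * Contracting an independent set *)

Definition shortcut E K : rel V :=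
  [rel u v | E u v || [exists k in K, E u k && E k v]].

Lemma within_shortcut E K n u v :
  within (shortcut E K) n u v -> within E n.*2 u v.
Proof.
elim: n u => // n IHn u /orP[/eqP->|/existsP[w /andP[/orP[Euw|]]]].
- exact: within_refl.
- move=> /IHn W; apply: (@within_mono _ n.*2.+1); first by lia.
  exact: within_step Euw W.
- case/exists_inP=> k _ /andP[Euk Ekw] /IHn W.
  by rewrite doubleS; apply: within_step Euk _; apply: within_step Ekw W.
Qed.

(** The set [T S] of the overview, when [K] is [K0]. *)
Definition pred_closure E K S : {set V} :=
  S :|: [set k in K | [exists v in S, E k v]].

Lemma pred_closureE E A K S u :
  S \subset A :\: K -> (u \in S) = (u \in pred_closure E K S) && (u \notin K).
Proof.
move=> /subsetP sS; rewrite !inE.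
have [uS|_] /= := boolP (u \in S); first by have:= sS u uS; rewrite inE => /andP[->].
by have [|] := boolP (u \in K); rewrite ?andbF.
Qed.

(** An arc from outside [K] to a vertex of [K] in the closure extends to a shortcut into [S], so its
    tail is in [S]; independence leaves only loops inside [K]. *)
Lemma pred_closure_source E A K S :
  K \subset A -> independent E K -> source_in (shortcut E K) (A :\: K) S ->
  source_in E A (pred_closure E K S).
Proof.
move=> sKA indK /source_inP[sSB clS]; apply/source_inP; split.
  rewrite subUset (subset_trans sSB) ?subsetDl //=.
  by apply: subset_trans sKA; apply/subsetP=> k; rewrite inE => /andP[].
move=> u v uA vT Euv; have [uK|uK] := boolP (u \in K).
  move: vT; rewrite inE => /orP[vS|].
    by rewrite !inE uK orbC; apply/orP; left; apply/exists_inP; exists v.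
  rewrite inE => /andP[vK Sv]; have [->|/eqP uv] := eqVneq u v.
    by rewrite !inE vK Sv orbT.
  by rewrite (negPf (indK u v uK vK uv)) in Euv.
have uB : u \in A :\: K by rewrite inE uK.
rewrite inE; apply/orP; left; move: vT; rewrite inE => /orP[vS|].
  by apply: clS vS _ => //; apply/orP; left.
rewrite inE => /andP[vK /exists_inP[w wS Evw]]; apply: clS wS _ => //.
by apply/orP; right; apply/exists_inP; exists v; rewrite // Euv.
Qed.

(** A shortcut into [C] is pulled back in two steps: its middle vertex lies in [K], hence in [A],
    hence in [C]. *)
Lemma source_shortcut E A K C :
  K \subset A -> source_in E A C ->
  source_in (shortcut E K) (A :\: K) (C :\: K).
Proof.
move=> /subsetP sKA /source_inP[sCA clC]; apply/source_inP; split.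
  exact: setSD.
move=> u v; rewrite !inE => /andP[-> uA] /andP[_ vC] /orP[Euv|].
  exact: (clC u v).
case/exists_inP=> k kK /andP[Euk Ekv].
by apply: (clC u k) => //; apply: (clC k v) => //; apply: sKA.
Qed.

(** Here [s] is r-2 in the notation of the overview, so [s.*2.+1] is 2r-3. *)
Lemma contractible_kernel E A s :
  0 < s -> (forall S, ~~ small_source E A s.+1 S) ->
  exists K, [/\ K \subset A, independent E K, dominates E s.*2.+1 A K &
    forall S, ~~ small_source (shortcut E K) (A :\: K) s S].
Proof.
move=> s_gt0 noS; have [K0 [sK0A indK0 domK0]] := quasi_kernel E A.
pose minimal S := minset (small_source (shortcut E K0) (A :\: K0) s) S.
pose T := pred_closure E K0.
have srcS S : minimal S -> source_in (shortcut E K0) (A :\: K0) S.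
  by case/minsetP=> /and3P[].
have sSB S : minimal S -> S \subset A :\: K0 by move/srcS/source_inP=> [].
have srcT S : minimal S -> source_in E A (T S).
  by move=> minS; apply: pred_closure_source => //; apply: srcS.
have clT S u v : minimal S -> u \in A -> v \in T S -> E u v -> u \in T S.
  by case/srcT/source_inP=> _; apply.
have cardT S : minimal S -> s.+1 < #|T S|.
  move=> minS; rewrite ltnNge; apply: contra (noS (T S)) => leT.
  apply/and3P; split=> //; last exact: srcT.
  case/minsetP: minS => /and3P[/set0Pn[v vS] _ _] _.
  by apply/set0Pn; exists v; rewrite inE vS.
have predT S k : minimal S -> k \in T S -> k \in K0 -> exists2 u, u \in S & E u k.
  move=> minS kT kK; have [u [uA /eqP uk Euk]] := in_neighbour_of noS (subsetP sK0A k kK).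
  exists u => //; rewrite (pred_closureE E _ (sSB S minS)) (clT S u k) //=.
  by apply/negP=> uK; rewrite (negPf (indK0 u k uK kK uk)) in Euk.
(* Strong connectivity of [T S], in the form used: [C] meets [S], through [predT] if [v] is in [K0],
   and then contains [S] by minimality, hence also its in-neighbours. *)
have strongT S C v : minimal S -> source_in E A C -> v \in T S -> v \in C ->
    T S \subset C.
  move=> minS srcC vT vC; have /source_inP[sCA clC] := srcC.
  have [w wS wC] : exists2 w, w \in S & w \in C.
    have [vK|vK] := boolP (v \in K0); last first.
      by exists v; rewrite // (pred_closureE E v (sSB S minS)) vK andbT.
    have [u uS Euv] := predT S v minS vT vK; exists u => //.
    apply: clC Euv => //.
    by have /subsetP/(_ u uS) := sSB S minS; rewrite inE => /andP[].
  have sSC : S \subset C.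
    have /minsetP[/and3P[_ _ leSs] min] := minS.
    have <- : S :&: (C :\: K0) = S; last by rewrite subIset ?subsetDl ?orbT.
    apply: min; last exact: subsetIl.
    apply/and3P; split.
    - apply/set0Pn; exists w; rewrite !inE wS wC andbT.
      by have /subsetP/(_ w wS) := sSB S minS; rewrite inE => /andP[].
    - by apply: source_inI (srcS S minS) _; apply: source_shortcut.
    - by apply: leq_trans leSs; apply: subset_leq_card; apply: subsetIl.
  rewrite subUset sSC; apply/subsetP=> k; rewrite inE => /andP[kK /exists_inP[y yS Eky]].
  by apply: clC Eky; [apply: (subsetP sK0A) | apply: (subsetP sSC)].
(* [pick] selects one representative as a function of [S], so equal minimal sets have equal
   representatives. *)
pose X := [set x | [exists S, minimal S && ([pick y in S] == Some x)]].
have XP x : x \in X -> exists S, [/\ minimal S, [pick y in S] = Some x & x \in S].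
  rewrite inE => /existsP[S /andP[minS /eqP pickS]]; exists S; split=> //.
  by move: pickS; case: pickP => // y yS [<-].
have repr S : minimal S -> exists x, [/\ x \in X, x \in S & [pick y in S] = Some x].
  move=> minS; have /minsetP[/and3P[/set0Pn[v vS] _ _] _] := minS.
  case pickS: [pick y in S] => [x|]; last first.
    by move: pickS; case: pickP => // /(_ v); rewrite vS.
  exists x; split=> //; last by move: pickS; case: pickP => // y yS [<-].
  by rewrite inE; apply/existsP; exists S; rewrite minS pickS eqxx.
have XB x : x \in X -> (x \in A) && (x \notin K0).
  by case/XP=> S [minS _ xS]; have /subsetP/(_ x xS) := sSB S minS; rewrite inE andbC.
have subT S x : x \in S -> x \in T S by move=> xS; rewrite inE xS.
have uniqX S x y : minimal S -> x \in X -> x \in T S -> [pick z in S] = Some y -> x = y.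
  move=> minS xX xT pickS; have [S' [minS' pickS' xS']] := XP x xX.
  have /andP[xA xK] := XB x xX.
  have xS : x \in S by rewrite (pred_closureE E x (sSB S minS)) xT.
  (* Two minimal source sets that share [x] coincide, since their intersection is again a small
     source set. *)
  suff eqS : S = S' by move: pickS; rewrite eqS pickS' => -[].
  have srcI := source_inI (srcS S minS) (srcS S' minS').
  have neI : S :&: S' != set0 by apply/set0Pn; exists x; rewrite inE xS.
  have /minsetP[/and3P[_ _ leS] min] := minS.
  have /minsetP[_ min'] := minS'.
  have smallI : small_source (shortcut E K0) (A :\: K0) s (S :&: S').
    rewrite /small_source neI srcI; apply: leq_trans leS.
    exact: subset_leq_card (subsetIl _ _).
  by rewrite -(min _ smallI (subsetIl _ _)); apply: min' (subsetIr _ _).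
pose K := X :|: [set k in K0 | ~~ [exists S, minimal S && (k \in T S)]
                              & ~~ [exists x in X, E x k]].
have KT S k : minimal S -> k \in K -> k \in T S -> k \in X.
  move=> minS; rewrite inE => /orP[//|]; rewrite inE => /and3P[_ /negP noT _] kT.
  by case: noT; apply/existsP; exists S; rewrite minS.
have sKA : K \subset A.
  apply/subsetP=> k; rewrite inE => /orP[/XB/andP[]//|].
  by rewrite inE => /andP[/(subsetP sK0A)].
(* An arc into a representative starts in its [T S], which meets [K] only in that representative;
   arcs from [X] to the rest of [K] were removed by construction. *)
have indK : independent E K.
  move=> u v uK vK uv; apply/negP=> Euv.
  have uA := subsetP sKA u uK.
  move: (vK); rewrite inE => /orP[vX|].
    have [S [minS pickS vS]] := XP v vX.
    have uT : u \in T S by apply: clT Euv => //; apply: subT.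
    by apply: uv; apply: uniqX pickS => //; apply: KT uT.
  rewrite inE => /and3P[vK0 _ /negP noX]; move: uK; rewrite inE => /orP[uX|].
    by apply: noX; apply/exists_inP; exists u.
  by rewrite inE => /andP[uK0 _]; have:= indK0 u v uK0 vK0 uv; rewrite Euv.
(* At most s-1 shortcuts inside [S], each of at most two arcs, then one arc if [v] is in [K0]:
   2(s-1)+1 in all. *)
have reachT S x v : minimal S -> x \in S -> v \in T S -> within E s.*2.-1 x v.
  move=> minS xS vT; have [vK|vK] := boolP (v \in K0).
    have [u uS Euv] := predT S v minS vT vK.
    have := within_shortcut (minimal_source_within minS xS uS).
    move=> /within_trans/(_ (within_arc Euv)); apply: within_mono; lia.
  have vS : v \in S by rewrite (pred_closureE E v (sSB S minS)) vT.
  have := within_shortcut (minimal_source_within minS xS vS).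
  by apply: within_mono; lia.
exists K; split=> // [v vA|S2].
  (* If [k] is kept, 2 steps suffice; if it lies in some [T S], (2s-1)+2; if it is an out-neighbour
     of [X], 1+2, which is at most 2s+1 as [s] is positive. *)
  have [k kK0 Wkv] := domK0 v vA.
  have [kK|] := boolP (k \in K); first by exists k => //; apply: within_mono Wkv; lia.
  rewrite !inE negb_or kK0 andTb negb_and !negbK => /andP[_ /orP[/existsP[S]|]].
    case/andP=> minS kT; have [x [xX xS _]] := repr S minS; exists x.
      by rewrite inE xX.
    by apply: within_mono (within_trans (reachT S x k minS xS kT) Wkv); lia.
  case/exists_inP=> x xX Exk; exists x; first by rewrite inE xX.
  by apply: within_mono (within_step Exk Wkv); lia.
apply/negP=> /and3P[neS2 srcS2 leS2].
have /source_inP[sS2 _] := srcS2.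
have srcT2 := pred_closure_source sKA indK srcS2.
set T2 := pred_closure E K S2 in srcT2; have /source_inP[_ clT2] := srcT2.
(* Otherwise [T S] is contained in [T2], hence in [x |: S2], which has at most s+1 elements, against
   [cardT]. *)
have disjT S v : minimal S -> v \in T S -> v \notin T2.
  move=> minS vT; apply/negP=> vT2; have sTT2 := strongT S T2 v minS srcT2 vT vT2.
  have [x [xX xS pickS]] := repr S minS.
  have sTx : T S \subset x |: S2.
    apply/subsetP=> y yT; rewrite in_setU1 (pred_closureE E y sS2) (subsetP sTT2) //=.
    have [yK|] := boolP (y \in K); rewrite ?orbT // orbF.
    by apply/eqP; apply: uniqX pickS => //; apply: KT yT.
  have := leq_trans (cardT S minS) (subset_leq_card sTx).
  by rewrite cardsU1 ltnNge -add1n leq_add ?leq_b1.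
have disjX x : x \in X -> x \notin T2.
  by case/XP=> S [minS _ xS]; apply: disjT (minS) _; apply: subT.
(* A vertex of [K0] outside [K] lies in some [T S] or has an in-neighbour in [X]; both would make
   [T2] meet a forbidden set. *)
have S2K0 k : k \in S2 -> k \notin K0.
  move=> kS2; apply/negP=> kK0; have kT2 : k \in T2 by rewrite inE kS2.
  have /subsetP/(_ k kS2) := sS2; rewrite inE => /andP[+ kA].
  rewrite !inE negb_or kK0 andTb negb_and !negbK => /andP[_ /orP[/existsP[S]|]].
    by case/andP=> minS /(disjT _ _ minS); rewrite kT2.
  case/exists_inP=> x xX Exk; have /andP[xA _] := XB x xX.
  by have := disjX x xX; rewrite (clT2 x k).
(* Since [T2] avoids [X] and [S2] avoids [K0], the set [S2] is already a source set of D / [K0]. It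
   then contains a minimal one, whose representative lies in [T2]: a contradiction. *)
have small0 : small_source (shortcut E K0) (A :\: K0) s S2.
  apply/and3P; split=> //; apply/source_inP; split.
    apply/subsetP=> k kS2; rewrite inE S2K0 //.
    by have /subsetP/(_ k kS2) := sS2; rewrite inE => /andP[].
  move=> u v; rewrite inE => /andP[uK0 uA] vS2 Euv.
  have vT2 : v \in T2 by rewrite inE vS2.
  have uT2 : u \in T2.
    case/orP: Euv => [|/exists_inP[k kK0 /andP[Euk Ekv]]]; first exact: (clT2 u v).
    by apply: (clT2 u k) => //; apply: (clT2 k v) => //; apply: (subsetP sK0A).
  rewrite (pred_closureE E u sS2) uT2 andTb; apply/negP; rewrite inE => /orP[/disjX|].
    by rewrite uT2.
  by rewrite inE (negPf uK0).
have [S minS sSS2] := minset_exists small0.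
have [x [xX xS _]] := repr S minS.
by have := disjX x xX; rewrite inE (subsetP sSS2).
Qed.

(** * Disjoint kernels *)

Lemma beta_entrySSS r i : beta_entry r.+3 i =
  if i < r.+3 then 2 * (beta_entry r.+2 i + r.+1) else r.+1.*2.+1.
Proof.
have -> : r.+1.*2.+1 = 2 * r.+3 - 3 by lia.
by have -> : r.+1 = r.+3 - 2 by lia.
Qed.

(** Both [E] and [A] vary, so that the induction can pass to D / [K] without changing the vertex
    type. Indices start at 0, whence [i.+1] in [beta_entry]. *)
Lemma beta_kernel_in r E A :
  (forall S, ~~ small_source E A r.+1 S) ->
  exists Q : nat -> {set V},
    [/\ forall i, i < r.+2 -> Q i \subset A,
        forall i j, i < j < r.+2 -> [disjoint Q i & Q j],
        forall i, i < r.+2 -> independent E (Q i) &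
        forall i, i < r.+2 -> dominates E (beta_entry r.+2 i.+1) A (Q i)].
Proof.
elim: r E A => [|r IHr] E A noS.
  have [K [sKA indK domK]] := quasi_kernel E A.
  have [L [sLA indL domL]] := quasi_kernel E (A :\: K).
  exists (fun i => if i == 0 then L else K); split.
  - by case=> [|i] _ //=; apply: subset_trans sLA (subsetDl _ _).
  - move=> i j /andP[ij j2]; have [-> ->] : i = 0 /\ j = 1 by lia.
    by apply: disjointWl sLA _; rewrite disjoints_subset setDE subsetIr.
  - by case=> [|[]].
  - case=> [|[]] // _ v vA.
    (* By independence a vertex of [K] has an in-neighbour outside [K], which [L] reaches in two
       steps; hence the bound 3. *)
    have [vK|vK] := boolP (v \in K).
      have [u [uA /eqP uv Euv]] := in_neighbour_of noS vA.
      have [|w wL Wwu] := domL u.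
        rewrite inE uA andbT; apply/negP=> uK.
        by have:= indK u v uK vK uv; rewrite Euv.
      by exists w => //; exact: within_trans Wwu (within_arc Euv).
    have [|w wL Wwv] := domL v; first by rewrite inE vK.
    by exists w => //; apply: (@within_mono _ 2 3).
have [K [sKA indK domK noS']] := contractible_kernel (ltn0Sn r) noS.
have [Q [sQ disQ indQ domQ]] := IHr _ _ noS'.
exists (fun i => if i < r.+2 then Q i else K); split=> [i _|i j|i _|i].
- by case: ifP => // /sQ sQi; apply: subset_trans sQi (subsetDl _ _).
- move=> ij; have -> : i < r.+2 by lia.
  case: ifP => [jr|_]; first by apply: disQ; lia.
  have sQi : Q i \subset A :\: K by apply: sQ; lia.
  by apply: disjointWl sQi _; rewrite disjoints_subset setDE subsetIr.
- case: ifP => // /indQ indQi u v uQ vQ uv.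
  by apply: contra (indQi u v uQ vQ uv) => Euv; apply/orP; left.
- move=> ir v vA; rewrite beta_entrySSS [i.+1 < _]ltnS; case: ifP => [i_lt|i_ge].
    (* Walks of length [n] in D / [K] double in [E], and one more arc reaches the vertices of [K];
       the total 2n+1 fits the recursion because [r.+1] is positive. *)
    have [n domn lebn] : exists2 n, dominates (shortcut E K) n (A :\: K) (Q i)
        & n.*2.+1 <= 2 * (beta_entry r.+2 i.+1 + r.+1).
      by exists (beta_entry r.+2 i.+1); [apply: domQ | lia].
    have domB w : w \in A :\: K -> exists2 u, u \in Q i & within E n.*2 u w.
      by move=> /domn[u uQ W]; exists u => //; apply: within_shortcut W.
    have [vK|vK] := boolP (v \in K).
      have [u [uA /eqP uv Euv]] := in_neighbour_of noS vA.
      have [|w wQ Wwu] := domB u.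
        rewrite inE uA andbT; apply/negP=> uK.
        by have:= indK u v uK vK uv; rewrite Euv.
      exists w => //; apply: within_mono (within_trans Wwu (within_arc Euv)).
      by rewrite addn1.
    have [|w wQ Wwv] := domB v; first by rewrite inE vK.
    by exists w => //; apply: within_mono Wwv; apply: ltnW.
  exact: domK.
Qed.

End Digraph.

Theorem theorem5p2 (r : nat) (V : finType) (E : rel V) :
  2 <= r ->
  ~ (exists S : {set V}, s_source_set E (r - 1) S) ->
  exists Q : r.-tuple {set V}, vkernel E (beta r) Q.
Proof.
case: r => [|[|r]] // _ noS.
have [|Q [_ disQ indQ domQ]] := @beta_kernel_in V r E [set: V].
  move=> S; apply/negP=> /and3P[/eqP neS /source_setP srcS leS].
  by apply: noS; exists S; split=> //; rewrite subn1.
exists [tuple Q i | i < r.+2]; split=> [i j neq_ij|i].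
  rewrite !tnth_mktuple; have [lt|lt|/val_inj//] := ltngtP i j.
    by apply: disQ; rewrite lt ltn_ord.
  by rewrite disjoint_sym; apply: disQ; rewrite lt ltn_ord.
rewrite !tnth_mktuple; split=> [|v]; first exact: indQ.
by have [|u uQ W] := domQ i (ltn_ord i) v; [rewrite inE | apply: oleq_dist W].
Qed.
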